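(* Let $P=(P_{i,j})_{0\le i,j\le N}$ be an irreducible block-form transition matrix with finitely many levels, partitioned into $r\times r$ blocks. Running the forward block-elimination of the block-form GTH algorithm on $P$ gives the $RG$-factorization $$I-P=(I-R_U)(I-\Phi_D)(I-G_L),$$ where $R_U$ is the strictly upper block-triangular matrix with blocks $R_{i,j}$ ($0\le i<j\le N$), $\Phi_D=\mathrm{diag}(\Phi_0,\Phi_1,\dots,\Phi_N)$ with $\Phi_k=P^{(k)}_{k,k}$, and $G_L$ is the strictly lower block-triangular matrix with blocks $G_{i,j}$ ($0\le j<i\le N$).
   Context: States are $(i,\alpha)$ with level $i\in\{0,\dots,N\}$ and phase $\alpha\in\{1,\dots,r\}$; $L_i=\{(i,\alpha):1\le\alpha\le r\}$, $L_{\le n}=\bigcup_{i=0}^nL_i$; $(X_n)$ is the Markov chain with transition matrix $P$, and $P_{i,j}$ is the block of transitions from $L_i$ to $L_j$. Forward block-elimination of the block-form GTH algorithm: starting from $P^{\langle N\rangle}=P$, eliminate the levels $k=N,N-1,\dots,1$ successively by $$P_{i,j}^{\langle k-1\rangle}=P_{i,j}^{\langle k\rangle}+P_{i,k}^{\langle k\rangle}\bigl(I-P_{k,k}^{\langle k\rangle}\bigr)^{-1}P_{k,j}^{\langle k\rangle},\qquad 0\le i,j\le k-1.$$ $R$-measure: for $0\le i<j\le N$, $R_{i,j}$ is the $r\times r$ matrix whose $(\alpha,\beta)$ entry is the expected number of visits to $(j,\beta)$ before hitting (at a time $\ge1$) any state in $L_{\le j-1}$, given $X_0=(i,\alpha)$.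 $G$-measure: for $0\le j<i\le N$, $G_{i,j}$ is the $r\times r$ matrix whose $(\alpha,\beta)$ entry is the probability of hitting $(j,\beta)$ when the process enters $L_{\le i-1}$ for the first time, given $X_0=(i,\alpha)$. $P^{(k)}$ is the transition matrix of the chain censored to $L_{\le k}$ (the chain observed only at its successive visits to $L_{\le k}$), with $P^{(N)}=P$, and $P^{(k)}_{k,k}$ is its block of transitions from level $k$ to level $k$. *)

(* Defs.v *)
From HB Require Import structures.
From mathcomp Require Import all_boot all_order all_algebra.
From mathcomp Require Import all_classical all_reals all_analysis.

Set Implicit Arguments.
Unset Strict Implicit.
Unset Printing Implicit Defensive.

Import Order.TTheory GRing.Theory Num.Theory.
Local Open Scope classical_set_scope.
Local Open Scope ring_scope.

(* Levels are 'I_N.+1 = {0, .., N}; the r phases are numbered from 0. *)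
Notation state N r := ('I_N.+1 * 'I_r)%type.
Notation blocks R N r := ('I_N.+1 -> 'I_N.+1 -> 'M[R]_r).
(* Square matrices of order (N + 1) r, cut into r x r blocks
   [submxblock P i j]. *)
Notation block_matrix R N r := ('M[R]_(\sum_(i < N.+1) r)).

Section Matrices.
Variable R : realType.

Definition stochastic_mx (m : nat) (A : 'M[R]_m) : Prop :=
  (forall x y, 0 <= A x y) /\ (forall x, \sum_y A x y = 1).

Definition irreducible_mx (m : nat) (A : 'M[R]_m) : Prop :=
  forall x y, exists n : nat, 0 < (A ^+ n) x y.

Variables N r : nat.

Definition transition (P : block_matrix R N r) (s t : state N r) : R :=
  submxblock P s.1 t.1 s.2 t.2.

Definition gth_step (k : 'I_N.+1) (Q : blocks R N r) : blocks R N r :=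
  fun i j => Q i j + Q i k *m invmx (1%:M - Q k k) *m Q k j.

Fixpoint gth_elim (P : block_matrix R N r) (m : nat) : blocks R N r :=
  if m is m'.+1 then gth_step (inord (N - m')) (gth_elim P m')
  else fun i j => submxblock P i j.

(* P^<k>, obtained by eliminating the levels N, N - 1, .., k + 1.  Only the
   blocks with i, j <= k are meaningful, and only they are used to compute the
   meaningful blocks of the next stages.  [invmx] is the identity on singular
   matrices, so invertibility has to be asserted separately. *)
Definition gth (P : block_matrix R N r) (k : 'I_N.+1) : blocks R N r :=
  gth_elim P (N - k).

Definition upper_mx (B : blocks R N r) : block_matrix R N r :=
  \mxblock_(i < N.+1, j < N.+1) (if (i < j)%N then B i j else 0).

Definition lower_mx (B : blocks R N r) : block_matrix R N r :=
  \mxblock_(i < N.+1, j < N.+1) (if (j < i)%N then B i j else 0).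

Definition diagonal_mx (D : 'I_N.+1 -> 'M[R]_r) : block_matrix R N r :=
  \mxdiag_(i < N.+1) D i.

End Matrices.

Section Chain.
Context {R : realType} {N r : nat} {d : measure_display} {T : measurableType d}.
Variables (X : nat -> T -> state N r) (Pr : state N r -> probability T R).

(* Pr s is the law of the process given X_0 = s.  The last clause is the Markov
   property P(X_(n+1) = x_(n+1) | X_0 = x_0, .., X_n = x_n) = P(x_n, x_(n+1)),
   multiplied out so that null histories need no special treatment. *)
Definition markov_chain (P : block_matrix R N r) : Prop :=
  [/\ forall n (t : state N r), measurable [set w | X n w = t],
      forall s, Pr s [set w | X 0%N w = s] = 1%E &
      forall s (n : nat) (x : nat -> state N r),
        Pr s [set w | forall m, (m <= n.+1)%N -> X m w = x m] =
        (Pr s [set w | forall m, (m <= n)%N -> X m w = x m] *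
         (transition P (x n) (x n.+1))%:E)%E].

Definition levels_le (n : nat) : set (state N r) := [set s : state N r | (s.1 <= n)%N].

(* No state of A is hit at the times 1, .., n. *)
Definition avoids (A : set (state N r)) (n : nat) : set T :=
  [set w | forall m, (0 < m <= n)%N -> ~ A (X m w)].

Definition visit_before_hitting (A : set (state N r)) (t : state N r)
    (n : nat) : set T :=
  [set w | X n w = t] `&` avoids A n.

Definition expected_visits (A : set (state N r)) (s t : state N r) : \bar R :=
  (\int[Pr s]_w \sum_(0 <= n <oo) (\1_(visit_before_hitting A t n) w)%:E)%E.

(* [fine] sends +oo to 0: the entries are the expectations only once these are
   known to be finite. *)
Definition R_measure (i j : 'I_N.+1) : 'M[R]_r :=
  \matrix_(a, b) fine (expected_visits (levels_le j.-1) (i, a) (j, b)).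

Definition first_entry_at (A : set (state N r)) (t : state N r) : set T :=
  [set w | exists n : nat,
    [/\ (0 < n)%N, avoids A n.-1 w, A (X n w) & X n w = t]].

Definition G_measure (i j : 'I_N.+1) : 'M[R]_r :=
  \matrix_(a, b) fine (Pr (i, a) (first_entry_at (levels_le i.-1) (j, b))).

(* The event X^(k)_n = t, where X^(k) is the chain censored to the levels at
   most k: t is the state at the visit to these levels preceded by exactly n
   earlier visits. *)
Definition censored_at (k n : nat) (t : state N r) : set T :=
  [set w | exists m : nat,
    [/\ (\sum_(l < m) ((X l w).1 <= k)%N)%N = n, levels_le k (X m w) &
        X m w = t]].

(* Starting from s in the levels at most k, the censored chain starts at s, so
   its transition probabilities are the laws of X^(k)_1. *)
Definition censored_block (k i j : 'I_N.+1) : 'M[R]_r :=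
  \matrix_(a, b) fine (Pr (i, a) (censored_at k 1 (j, b))).

Definition Phi (k : 'I_N.+1) : 'M[R]_r := censored_block k k k.

End Chain.

(* Main.v *)
Require Import Defs.
From HB Require Import structures.
From mathcomp Require Import all_boot all_order all_algebra.
From mathcomp Require Import all_classical all_reals all_analysis.
From mathcomp Require Import measurable_realfun.

(** Each of the three factors is a block of one family of matrices.  For a set
    [A] of states let [T_A] be [P] with the columns in [A] set to zero (the
    transitions that stay out of [A]), and let
    [H_A = (I - T_A)^-1 P = P + T_A P + T_A^2 P + ...].

    - Probabilistic meaning.  By the Markov property, [(T_A^n P) s t] is the
      probability, from [s], to be at [t] at time [n + 1] after avoiding [A] at
      the times [1, .., n] ([taboo_law]).  Summing over [n], [H_A s t] is the
      probability that [A] is first entered at [t] when [t] lies in [A]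
      ([first_entry_law]), and the expected number of visits to [t] before
      hitting [A] when [t] lies outside [A] and differs from [s]
      ([expected_visits_law]).  With [A] the levels at most [k], write [H_k]:
      then [Phi_k = H_k(k, k)], and [R_(i, j) = H_(j-1)(i, j)],
      [G_(i, j) = H_(i-1)(i, j)].

    - Convergence.  [I - T_A] is invertible when [A] is nonempty, by a maximum
      principle: a fixed vector of [T_A] has constant modulus along the
      transitions from a point where it is maximal, and these never enter [A],
      against irreducibility ([taboo_mx_unit]).  The partial sums of the powers
      of [T_A] are monotone and bounded, so the geometric series does converge
      to [(I - T_A)^-1] ([taboo_mx_series_cvg]).

    - Elimination.  Shrinking [A] by the level [k] gives
      [H_(k-1) = H_k + H_k E_k H_(k-1)], where [E_k] is the projection on level
      [k]: split a path at its first visit to level [k].  Solving for the row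
      [k] of [H_(k-1)] turns this into the elimination step, so that
      [P^<k> = H_k] ([gth_censored]); its row [k] and column [k] are the
      formulas for [G] and [R].

    - Factorization.  The [(i, j)] block of the product of the three factors is
      a sum over levels [l], whose terms with [l > max(i, j)] equal
      [H_(l-1)(i, j) - H_l(i, j)] by the elimination step.  The sum telescopes
      down to [H_N = P] ([RG_factorization]). *)

Set Implicit Arguments.
Unset Strict Implicit.
Unset Printing Implicit Defensive.

Import Order.TTheory GRing.Theory Num.Theory.
Import numFieldNormedType.Exports.
Local Open Scope classical_set_scope.
Local Open Scope ring_scope.

(** * Substochastic matrices with a taboo set *)

Lemma mx_expr_ge0 (R : realType) (m : nat) (A : 'M[R]_m) :
  (forall x y, 0 <= A x y) -> forall n x y, 0 <= (A ^+ n) x y.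
Proof.
move=> A0; elim=> [|n IHn] x y; first by rewrite expr0 mxE ler0n.
by rewrite exprS mxE sumr_ge0// => z _; rewrite mulr_ge0.
Qed.

Lemma mx_expr_gt0_closed (R : realType) (m : nat) (A : 'M[R]_m)
    (Q : 'I_m -> Prop) :
  (forall x y, 0 <= A x y) ->
  (forall x y, Q x -> 0 < A x y -> Q y) ->
  forall n x y, Q x -> 0 < (A ^+ n) x y -> Q y.
Proof.
move=> A0 cQ; elim=> [|n IHn] x y Qx.
  by rewrite expr0 mxE ltr0n lt0b => /eqP <-.
rewrite exprS mxE => /lt0r_neq0/eqP/psumr_neq0P[z _|z /andP[_]].
  by rewrite mulr_ge0// mx_expr_ge0.
rewrite lt0r mulf_eq0 negb_or => /andP[/andP[xz zy] _].
apply: (IHn z); last by rewrite lt0r zy mx_expr_ge0.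
by apply: (cQ x) => //; rewrite lt0r xz A0.
Qed.

Section Taboo.
Variables (R : realType) (m : nat) (P : 'M[R]_m).
Hypothesis hP : stochastic_mx P.
Implicit Type A : pred 'I_m.

Definition taboo_mx A : 'M[R]_m := \matrix_(x, y) (P x y *+ ~~ A y).

(** The sum over [n] of [T_A^n P], which [taboo_mx_series_cvg] shows to
    converge.  Its columns in [A] are first entrance distributions, the other
    ones are expected numbers of visits before entering [A]. *)
Definition hitting_mx A : 'M[R]_m := invmx (1%:M - taboo_mx A) *m P.

Let P_ge0 x y : 0 <= P x y. Proof. by case: hP. Qed.

Let P_sum x : \sum_y P x y = 1. Proof. by case: hP. Qed.

Lemma taboo_mx_ge0 A x y : 0 <= taboo_mx A x y.
Proof. by rewrite mxE mulrn_wge0. Qed.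

Lemma taboo_mx_sum_le1 A x : \sum_y taboo_mx A x y <= 1.
Proof.
rewrite -(P_sum x); apply: ler_sum => y _; rewrite mxE.
by case: (A y); rewrite ?mulr0n.
Qed.

Lemma taboo_mx_expr_le1 A n x y : (taboo_mx A ^+ n) x y <= 1.
Proof.
have T0 := mx_expr_ge0 (taboo_mx_ge0 A).
suff rows : \sum_z (taboo_mx A ^+ n) x z <= 1.
  by apply: le_trans rows; rewrite (bigD1 y)//= lerDl sumr_ge0.
elim: n x => [|n IHn] x.
  rewrite expr0 (bigD1 x)//= big1 ?mxE ?eqxx ?addr0// => z /negPf zx.
  by rewrite mxE eq_sym zx.
rewrite exprS; under eq_bigr do rewrite mxE.
rewrite exchange_big/= (le_trans _ (taboo_mx_sum_le1 A x))//.
by apply: ler_sum => z _; rewrite -mulr_sumr ler_piMr// taboo_mx_ge0.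
Qed.

(** At a point [x] where [|v|] takes its maximal value [M], the number [M] is at
    most the average under [P x] of quantities [(1 - 1_A) |v| <= M], which
    forces equality wherever [P x] has mass. *)
Lemma taboo_harmonic_max_step A (v : 'I_m -> R) (M : R) :
  (forall x, v x = \sum_y taboo_mx A x y * v y) ->
  (forall x, `|v x| <= M) -> 0 < M ->
  forall x y, `|v x| = M -> 0 < P x y -> ~~ A y /\ `|v y| = M.
Proof.
move=> vE vM M0 x y vxM Pxy.
have defect_ge0 z : true -> 0 <= P x z * (M - `|v z| *+ ~~ A z).
  move=> _; rewrite mulr_ge0// subr_ge0.
  by case: (A z); rewrite ?mulr0n ?mulr1n// ltW.
have defect0 : \sum_z P x z * (M - `|v z| *+ ~~ A z) = 0.
  apply/eqP; rewrite eq_le sumr_ge0 ?andbT; last by move=> z; exact: defect_ge0.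
  under eq_bigr do rewrite mulrBr.
  rewrite sumrB -mulr_suml P_sum mul1r subr_le0 -{1}vxM vE.
  apply: le_trans (ler_norm_sum _ _ _) _; apply: ler_sum => z _.
  by rewrite normrM mxE normrMn (ger0_norm (P_ge0 x z)) mulrnAl mulrnAr.
have /eqP := psumr_eq0P defect_ge0 defect0 (erefl : xpredT y).
rewrite mulf_eq0 gt_eqF//= subr_eq0 => /eqP MvA; move: M0; rewrite MvA.
by case: (A y); rewrite ?mulr0n ?ltxx.
Qed.

(** A nonzero fixed vector of [T_A] would have maximal modulus at some [x],
    hence also at every state reachable from [x]; all of these lie outside [A],
    whereas an irreducible chain reaches [A]. *)
Lemma taboo_mx_unit A : irreducible_mx P -> (exists a, A a) ->
  1%:M - taboo_mx A \in unitmx.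
Proof.
move=> irr [a Aa]; rewrite unitmxE unitfE -det_tr.
apply/negP => /det0P[u u0 /(congr1 trmx)].
rewrite trmx_mul trmxK trmx0 mulmxBl mul1mx => /eqP.
rewrite subr_eq0 => /eqP uE.
pose v x := u 0 x.
have vE x : v x = \sum_y taboo_mx A x y * v y.
  have /matrixP/(_ x 0) := uE; rewrite mxE /v => ->; rewrite mxE.
  by apply: eq_bigr => y _; rewrite !mxE.
have [x _ xmax] := arg_maxP (fun x => `|v x|) (erefl : xpredT a).
have vx0 : 0 < `|v x|.
  rewrite lt_neqAle normr_ge0 andbT eq_sym; apply: contra_neq u0 => vx0.
  apply/rowP => y; rewrite mxE; apply/eqP; rewrite -normr_le0 -vx0.
  exact: xmax.
have step := taboo_harmonic_max_step vE (fun y => xmax y erefl) vx0.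
(* The maximum principle gives no information on [x] itself, which may belong
   to [A], so the path to [a] is taken from a successor of [x]. *)
have [y Pxy] : exists y, 0 < P x y.
  have /psumr_neq0P : \sum_y P x y <> 0 by rewrite P_sum; apply/eqP/oner_neq0.
  by case=> // y ?; exists y.
have [n Pya] := irr y a.
have [nAa _] : ~~ A a /\ `|v a| = `|v x|.
  apply: (@mx_expr_gt0_closed _ _ P
            (fun z => ~~ A z /\ `|v z| = `|v x|) _ _ n y a) => //.
    by move=> z t [_ zx]; exact: step.
  exact: (step x).
by rewrite Aa in nAa.
Qed.

Lemma hitting_mxE A : 1%:M - taboo_mx A \in unitmx ->
  hitting_mx A = P + taboo_mx A *m hitting_mx A.
Proof.
move=> U; apply/eqP; rewrite -subr_eq; apply/eqP.
by rewrite -{1}[hitting_mx A]mul1mx -mulmxBl mulKVmx.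
Qed.

(** The inverse [M] of [I - T] exists beforehand, so the partial geometric sums
    are [M - M T^n].  As [T^n] has entries in [0, 1] these sums are bounded, and
    being monotone they converge; therefore [T^n] tends to 0. *)
Lemma taboo_mx_series_cvg A : 1%:M - taboo_mx A \in unitmx -> forall x y,
  series (fun n => (taboo_mx A ^+ n *m P) x y) @ \oo --> hitting_mx A x y.
Proof.
move=> U; set T := taboo_mx A; set M := invmx (1%:M - T).
have T0 := mx_expr_ge0 (taboo_mx_ge0 A).
have geomE n : \sum_(0 <= k < n) T ^+ k = M - M *m T ^+ n.
  have -> : M - M *m T ^+ n = M *m (1%:M - T ^+ n) by rewrite mulmxBr mulmx1.
  apply: (canRL (mulKmx U)); rewrite mulmx_sumr.
  elim: n => [|n IHn]; first by rewrite big_nil expr0 subrr.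
  rewrite big_nat_recr//= IHn mulmxBl mul1mx exprS.
  by rewrite addrA subrK.
have geom_entry n x y :
    series (fun n => (T ^+ n) x y) n = M x y - \sum_z M x z * (T ^+ n) z y.
  have /matrixP/(_ x y) := geomE n.
  by rewrite summxE /series/= => ->; rewrite !mxE.
have T_cvg0 x y : (fun n => (T ^+ n) x y) @ \oo --> 0.
  apply: cvg_series_cvg_0; apply: nondecreasing_is_cvgn.
    apply/nondecreasing_seqP => n.
    by rewrite /series/= big_nat_recr//= lerDl T0.
  exists (M x y + \sum_z `|M x z|) => _ [n _ <-].
  rewrite geom_entry lerD2l -sumrN; apply: ler_sum => z _.
  rewrite (le_trans (ler_norm _))// normrN normrM ler_piMr//.
  by rewrite ger0_norm ?T0// taboo_mx_expr_le1.
move=> x y.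
rewrite (_ : series _ =
  fun n => \sum_z series (fun n => (T ^+ n) x z) n * P z y).
  rewrite /hitting_mx mxE; apply: cvg_big => [|z _].
    exact: add_continuous.
  apply: cvgMr_tmp.
  rewrite (_ : series _ = fun n => M x z - \sum_t M x t * (T ^+ n) t z);
    last by apply/funext => n; exact: geom_entry.
  rewrite -[X in _ --> X]subr0; apply: cvgB; first exact: cvg_cst.
  rewrite [X in _ --> X](_ : 0 = \sum_t M x t * 0); last first.
    by rewrite big1// => t; rewrite mulr0.
  apply: cvg_big => [|t _]; first exact: add_continuous.
  by apply: cvgMl_tmp; exact: T_cvg0.
apply/funext => n; rewrite /series/=.
under [in RHS]eq_bigr do rewrite mulr_suml.
by rewrite exchange_big/=; apply: eq_bigr => k _; rewrite mxE.
Qed.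

End Taboo.

(** * Enlarging the set of permitted states *)

Lemma submxblockM (R : pzSemiRingType) (p q s : nat) (p_ : 'I_p -> nat)
    (q_ : 'I_q -> nat) (s_ : 'I_s -> nat)
    (A : 'M[R]_(\sum_i p_ i, \sum_j q_ j))
    (B : 'M[R]_(\sum_j q_ j, \sum_k s_ k)) i k :
  submxblock (A *m B) i k = \sum_j submxblock A i j *m submxblock B j k.
Proof.
by rewrite -{1}[A]submxblockK -{1}[B]submxblockK mul_mxblock mxblockK.
Qed.

Definition restrict_mx (R : realType) (m : nat) (B : pred 'I_m) : 'M[R]_m :=
  diag_mx (\row_x (B x)%:R).

Section Enlarge.
Variables (R : realType) (m : nat) (P : 'M[R]_m) (A A' : pred 'I_m).
Hypothesis sA'A : forall x, A' x -> A x.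
Hypothesis unitA : 1%:M - taboo_mx P A \in unitmx.
Hypothesis unitA' : 1%:M - taboo_mx P A' \in unitmx.

Local Notation D := (restrict_mx R [pred x | A x && ~~ A' x]).
Local Notation H := (hitting_mx P A).

(** With [D] the projection on the newly permitted states,
    [T_A' = T_A + P D], and [P = (I - T_A) H_A]. *)
Lemma hitting_mx_factor :
  (1%:M - taboo_mx P A) *m (1%:M - H *m D) = 1%:M - taboo_mx P A'.
Proof.
rewrite mulmxBr mulmx1 mulmxA mulKVmx// -addrA -opprD; congr (_ - _).
apply/matrixP => x y; rewrite mul_mx_diag !mxE/=.
case A'y: (A' y); first by rewrite (sA'A A'y) mulr0 addr0.
by case: (A y); rewrite ?mulr1 ?mulr0 ?add0r ?addr0.
Qed.

Lemma restrict_hitting_unit : 1%:M - H *m D \in unitmx.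
Proof. by have := unitA'; rewrite -hitting_mx_factor unitmx_mul => /andP[]. Qed.

(** First passage decomposition: up to its end, a path counted by [H_A'] either
    stays out of [A], or has a first visit to [A] minus [A'] and then starts
    afresh. *)
Lemma hitting_mx_enlarge :
  hitting_mx P A' = H + H *m D *m hitting_mx P A'.
Proof.
apply/eqP; rewrite -subr_eq -{1}[hitting_mx _ A']mul1mx -mulmxBl; apply/eqP.
apply: (can_inj (mulKmx unitA)).
by rewrite mulmxA hitting_mx_factor !mulKVmx.
Qed.

End Enlarge.

(** * Elimination of levels and the factorization *)

Section Levels.
Variables (R : realType) (N r : nat) (hr : (0 < r)%N) (P : block_matrix R N r).
Hypotheses (hP : stochastic_mx P) (hirr : irreducible_mx P).

Definition low_level (k : nat) : pred 'I_(\sum_(i < N.+1) r) :=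
  fun x => (tagnat.sig1 x <= k)%N.

(** On the levels at most [k] this is the transition matrix of the chain
    censored to these levels.  The other columns are needed too: column [k + 1]
    contains the R-measure. *)
Definition censored_mx (k : nat) : block_matrix R N r :=
  hitting_mx P (low_level k).

Definition censored_blk (k : nat) : blocks R N r :=
  fun i j => submxblock (censored_mx k) i j.

Local Notation H := censored_blk.

Lemma taboo_low_unit k : 1%:M - taboo_mx P (low_level k) \in unitmx.
Proof.
apply: taboo_mx_unit => //; exists (tagnat.Rank ord0 (Ordinal hr)).
by rewrite /low_level tagnat.Rank1K.
Qed.

Lemma censored_mx_last k : (N <= k)%N -> censored_mx k = P.
Proof.
move=> Nk; rewrite /censored_mx hitting_mxE ?taboo_low_unit//.
rewrite (_ : taboo_mx _ _ = 0) ?mul0mx ?addr0//.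
apply/matrixP => x y; rewrite !mxE /low_level.
by rewrite (leq_trans _ Nk)// -ltnS.
Qed.

Section Eliminate.
Variable k : 'I_N.+1.
Hypothesis k_gt0 : (0 < k)%N.

Let D : block_matrix R N r :=
  restrict_mx R [pred x | low_level k x && ~~ low_level k.-1 x].

Let lowS x : low_level k.-1 x -> low_level k x.
Proof. by move=> /leq_trans; apply; exact: leq_pred. Qed.

Let submxblock_restrict i j :
  submxblock D i j = if (i == j) && (i == k) then 1%:M else 0.
Proof.
apply/matrixP => a b; rewrite !mxE /= /low_level !tagnat.Rank1K.
rewrite -(inj_eq val_inj) tagnat.eq_Rank -ltnNge.
have -> : ((i <= k) && (k.-1 < i))%N = (i == k) by rewrite prednK// -eqn_leq.
by case: (i == j); case: (i == k); rewrite /= ?mul0rn ?mxE.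
Qed.

Let submxblock_mul (A B : block_matrix R N r) i j :
  submxblock (A *m B) i j = \sum_l submxblock A i l *m submxblock B l j.
Proof. exact: (@submxblockM _ _ _ _ (fun=> r) (fun=> r) (fun=> r)). Qed.

Let submxblock_mul_restrict (A B : block_matrix R N r) i j :
  submxblock (A *m D *m B) i j = submxblock A i k *m submxblock B k j.
Proof.
rewrite submxblock_mul (bigD1 k)//= [X in _ + X]big1 ?addr0 => [|l lk].
  rewrite submxblock_mul (bigD1 k)//= [X in _ + X]big1 ?addr0 => [|l lk].
    by rewrite submxblock_restrict !eqxx mulmx1.
  by rewrite submxblock_restrict (negPf lk) mulmx0.
rewrite submxblock_mul [X in X *m _]big1 ?mul0mx// => l' _.
by rewrite submxblock_restrict; case: eqP => [->|_]; rewrite ?(negPf lk) mulmx0.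
Qed.

(** [hitting_mx_enlarge] with [A'] obtained from [A] by removing level [k]. *)
Lemma censored_block_enlarge i j :
  H k.-1 i j = H k i j + H k i k *m H k.-1 k j.
Proof.
rewrite /censored_blk -submxblock_mul_restrict -submxblockD; congr submxblock.
exact: hitting_mx_enlarge (taboo_low_unit _) (taboo_low_unit _).
Qed.

(** Only level [k] is projected on, so the [(k, k)] block of
    [(I - H_k D) M = I] reads [(I - H_k(k, k)) M(k, k) = I]. *)
Lemma censored_block_unit : 1%:M - H k k k \in unitmx.
Proof.
have U : 1%:M - censored_mx k *m D \in unitmx.
  exact: restrict_hitting_unit (taboo_low_unit _) (taboo_low_unit _).
pose M := invmx (1%:M - censored_mx k *m D).
suff /mulmx1_unit[] : (1%:M - H k k k) *m submxblock M k k = 1%:M by [].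
have : submxblock ((1%:M - censored_mx k *m D) *m M) k k = 1%:M.
  by rewrite mulmxV//; apply/matrixP => a b; rewrite !mxE -(inj_eq val_inj)
    tagnat.eq_Rank eqxx.
by rewrite !mulmxBl !mul1mx submxblockB submxblock_mul_restrict.
Qed.

(** Row [k] of [censored_block_enlarge], solved for [H_(k-1)]. *)
Lemma censored_block_return j :
  H k.-1 k j = invmx (1%:M - H k k k) *m H k k j.
Proof.
apply: (can_inj (mulKmx censored_block_unit)).
rewrite mulKVmx ?censored_block_unit// mulmxBl mul1mx.
by rewrite {1}censored_block_enlarge addrK.
Qed.

Lemma censored_block_gth_step i j : H k.-1 i j = gth_step k (H k) i j.
Proof.
by rewrite /gth_step -mulmxA -censored_block_return -censored_block_enlarge.
Qed.

(** Column [k] of [censored_block_enlarge]: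
    [I + (I - H_k(k, k))^-1 H_k(k, k) = (I - H_k(k, k))^-1]. *)
Lemma censored_block_visits i :
  H k.-1 i k = H k i k *m invmx (1%:M - H k k k).
Proof.
rewrite censored_block_enlarge censored_block_return.
by rewrite -{1}[H k i k]mulmx1 -mulmxDr -{1}(mulVmx censored_block_unit)
  -mulmxDr subrK mulmx1.
Qed.

End Eliminate.

(** The recursions agree, and both start from [P]; the equality holds for all
    blocks, including those beyond level [k]. *)
Lemma gth_censored (k i j : 'I_N.+1) : gth P k i j = H k i j.
Proof.
suff elimE m : (m <= N)%N -> forall i j, gth_elim P m i j = H (N - m) i j.
  by rewrite /gth elimE ?leq_subr// subKn// -ltnS.
elim: m => [_ {}i {}j|m IHm mN {}i {}j] /=.
  by rewrite /censored_blk censored_mx_last ?subn0.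
set l := inord (N - m).
have lE : l = (N - m)%N :> nat by rewrite inordK// ltnS leq_subr.
rewrite /gth_step !IHm 1?ltnW// subnS -lE.
by rewrite censored_block_gth_step// lE subn_gt0.
Qed.

(** The [(i, j)] block of the product is a sum over levels [l], in which only
    [l >= max(i, j)] contribute.  The term [l = max(i, j)] is
    [delta_(i, j) I - H_l(i, j)], and each later one is
    [H_(l-1)(i, j) - H_l(i, j)]. *)
Lemma RG_factorization (U L : blocks R N r) (D : 'I_N.+1 -> 'M[R]_r) :
  (forall i j : 'I_N.+1, (i < j)%N ->
     U i j = H j i j *m invmx (1%:M - H j j j)) ->
  (forall k, D k = H k k k) ->
  (forall i j : 'I_N.+1, (j < i)%N ->
     L i j = invmx (1%:M - H i i i) *m H i i j) ->
  1%:M - P =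
    (1%:M - upper_mx U) *m (1%:M - diagonal_mx D) *m (1%:M - lower_mx L).
Proof.
move=> UE DE LE.
pose unitb (i j : 'I_N.+1) : 'M[R]_r := if i == j then 1%:M else 0.
have idE : 1%:M = \mxblock_(i < N.+1, j < N.+1) unitb i j :> block_matrix R N r.
  rewrite -[LHS](mxdiagZ (p_ := fun=> r)); congr mxblock; apply/funext => i.
  by apply/funext => j; rewrite /unitb conform_mx_id.
(* The partial sum of the terms below [n]. *)
pose stage (i j : 'I_N.+1) n : 'M[R]_r :=
  if (maxn i j < n)%N then unitb i j - H n.-1 i j else 0.
have termE i j (l : 'I_N.+1) :
    (unitb i l - (if (i < l)%N then U i l else 0)) *m (1%:M - D l)
      *m (unitb l j - (if (j < l)%N then L l j else 0))
    = stage i j l.+1 - stage i j l.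
  rewrite /stage /unitb !gtn_max !ltnS DE -!(inj_eq val_inj) /=.
  have [il|li|/val_inj ->] := ltngtP i l.
  - rewrite sub0r UE// mulNmx mulmxKV; last first.
      exact: censored_block_unit (leq_ltn_trans _ il).
    have [jl|lj|/val_inj ->] := ltngtP j l.
    + rewrite sub0r LE// mulNmx mulmxN opprK opprB [RHS]addrC subrKA.
      rewrite (censored_block_gth_step (leq_ltn_trans _ il))// /gth_step.
      by rewrite addrAC subrr add0r mulmxA.
    + by rewrite !subr0 mulmx0.
    + by rewrite subr0 mulmx1 (ltn_eqF il) sub0r subr0.
  - by rewrite !subr0 !mul0mx.
  - rewrite subr0 mul1mx.
    have [jl|lj|/val_inj ->] := ltngtP j l.
    + rewrite sub0r LE// mulmxN mulKVmx; last first.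
        exact: censored_block_unit (leq_ltn_trans _ jl).
      by rewrite sub0r subr0.
    + by rewrite !subr0 mulmx0.
    + by rewrite !subr0 mulmx1.
have factorE (B : blocks R N r) :
    1%:M - \mxblock_(i < N.+1, j < N.+1) B i j
    = \mxblock_(i < N.+1, j < N.+1) (unitb i j - B i j).
  by rewrite idE mxblockB.
have -> : 1%:M - diagonal_mx D = \mxdiag_(i < N.+1) (1%:M - D i).
  by rewrite mxdiagB mxdiagZ.
rewrite /upper_mx /lower_mx !factorE mul_mxblock_mxdiag mul_mxblock.
rewrite -{1}[P]submxblockK factorE; congr mxblock.
apply/funext => i; apply/funext => j; under [RHS]eq_bigr do rewrite termE.
rewrite -(big_mkord xpredT (fun l => stage i j l.+1 - stage i j l)).
rewrite telescope_sumr// /stage ltn0 subr0 /= gtn_max !ltn_ord.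
by rewrite /censored_blk censored_mx_last.
Qed.

End Levels.

(** * Laws of finite histories *)

Lemma measure_fin_partition (R : realType) (d : measure_display)
    (T : measurableType d) (mu : {measure set T -> \bar R}) (F : finType)
    (Y : T -> F) (C : pred F) (E : set T) :
  measurable E -> (forall y, measurable [set w | Y w = y]) ->
  mu (E `&` [set w | C (Y w)]) =
    (\sum_(y | C y) mu (E `&` [set w | Y w = y]))%E.
Proof.
move=> mE mY.
have -> : E `&` [set w | C (Y w)] =
    \bigcup_(y in [set y | C y]) (E `&` [set w | Y w = y]).
  rewrite predeqE => w; split=> [[Ew Cw]|[y Cy [Ew Yw]]]; first by exists (Y w).
  by split=> //=; rewrite Yw.
rewrite measure_fin_bigcup//.
- apply/esym/bigfs; first exact: index_enum_uniq.
  by move=> y _; rewrite mem_index_enum.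
- exact: finite_finset.
- by move=> y z _ _ [w [[_ <-] [_ <-]]].
- by move=> y _; exact: measurableI.
Qed.

Definition state_index (N r : nat) (s : state N r) : 'I_(\sum_(i < N.+1) r) :=
  tagnat.Rank (p_ := fun=> r) s.1 s.2.

Lemma state_index_bij (N r : nat) : bijective (@state_index N r).
Proof.
exists (fun x : 'I_(\sum_(i < N.+1) r) =>
  (tagnat.sig1 (p_ := fun=> r) x, tagnat.sig2 (p_ := fun=> r) x : 'I_r))
  => [[i a]|x]; last exact: tagnat.sig2K.
rewrite /state_index /=; congr pair; first exact: tagnat.Rank1K.
by apply/val_inj; rewrite /= tagnat.Rank2K.
Qed.

Lemma eseries_EFin_cvg (R : realType) (u : nat -> R) (l : R) :
  series u @ \oo --> l -> (\sum_(0 <= n <oo) (u n)%:E)%E = l%:E.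
Proof.
move=> ul; apply: cvg_lim => //.
rewrite (_ : (fun n => _) = EFin \o series u).
  by apply: cvg_EFin => //; exact: nearW.
by apply/funext => n; rewrite /= -sumEFin.
Qed.

Section Chain.
Variables (R : realType) (N r : nat) (P : block_matrix R N r).
Variables (d : measure_display) (T : measurableType d).
Variables (X : nat -> T -> state N r) (Pr : state N r -> probability T R).
Hypothesis hX : markov_chain X Pr P.

(** The path up to time [n] takes finitely many values, so that every event
    depending on it is a finite disjoint union of path events. *)
Definition history (n : nat) (w : T) : {ffun 'I_n.+1 -> state N r} :=
  [ffun i : 'I_n.+1 => X i w].

Let mX n t : measurable [set w | X n w = t].
Proof. by case: hX => + _ _; exact. Qed.

Lemma start_null s E : measurable E -> (forall w, E w -> X 0 w <> s) ->
  Pr s E = 0%E.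
Proof.
case: hX => _ start _ mE Es; apply/eqP; rewrite eq_le measure_ge0 andbT.
have <- : Pr s (~` [set w | X 0 w = s]) = 0%E.
  by rewrite probability_setC// start subee.
by apply: le_measure; rewrite ?inE//; exact: measurableC.
Qed.

Lemma measurable_history n x : measurable [set w | history n w = x].
Proof.
have -> : [set w | history n w = x] =
    \bigcap_(i in [set: 'I_n.+1]) [set w | X i w = x i].
  rewrite predeqE => w; split=> [<- i _|xw] /=; first by rewrite ffunE.
  by apply/ffunP => i; rewrite ffunE; exact: xw.
by apply: fin_bigcap_measurable => // i _; exact: mX.
Qed.

Lemma history_step s n (x : {ffun 'I_n.+1 -> state N r}) t :
  Pr s ([set w | X n.+1 w = t] `&` [set w | history n w = x]) =
  (Pr s [set w | history n w = x] * (transition P (x ord_max) t)%:E)%E.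
Proof.
case: hX => _ _ markov.
(* The path [x] prolonged by [t]. *)
pose y m := if (m <= n)%N then x (inord m) else t.
have yx m : (m <= n)%N -> y m = x (inord m) by rewrite /y => ->.
have historyE : [set w | history n w = x] =
    [set w | forall m, (m <= n)%N -> X m w = y m].
  rewrite predeqE => w; split=> [xw m mn|xw].
    by rewrite yx// -xw ffunE inordK.
  apply/ffunP => i; have iN : (i <= n)%N by rewrite -ltnS ltn_ord.
  by rewrite ffunE (xw i iN) (yx i iN) inord_val.
have -> : [set w | X n.+1 w = t] `&` [set w | history n w = x] =
    [set w | forall m, (m <= n.+1)%N -> X m w = y m].
  have yt : y n.+1 = t by rewrite /y ltnn.
  rewrite historyE predeqE => w; split=> [[Xt xw] m|xw].
    by rewrite leq_eqVlt => /predU1P[->|/xw//]; rewrite yt.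
  split=> [|m mn]; first by rewrite -yt; exact: xw.
  by apply: xw; exact: ltnW.
rewrite markov -historyE yx// /y ltnn; congr (_ * (transition _ (x _) _)%:E)%E.
by apply/val_inj; rewrite /= inordK.
Qed.

(** The Markov property for an event [C] of the past that need not be a
    single path: sum [history_step] over the paths in [C]. *)
Lemma markov_history s n (C : pred {ffun 'I_n.+1 -> state N r}) t :
  Pr s ([set w | X n.+1 w = t] `&` [set w | C (history n w)]) =
  (\sum_u Pr s ([set w | X n w = u] `&` [set w | C (history n w)])
          * (transition P u t)%:E)%E.
Proof.
rewrite (@measure_fin_partition _ _ _ _ _ (history n))//; last first.
  exact: measurable_history.
under [RHS]eq_bigr => u _.
  rewrite (@measure_fin_partition _ _ _ _ _ (history n))//; last first.
    exact: measurable_history.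
  rewrite ge0_sume_distrl; last by move=> x _; exact: measure_ge0.
  over.
rewrite exchange_big/=; apply: eq_bigr => x _.
apply: etrans (history_step s x t) _.
rewrite (bigD1 (x ord_max))//= big1 ?adde0 => [|u ux].
  congr (Pr s _ * _)%E; rewrite predeqE => w; split=> [xw|[]//]; split=> //.
  by rewrite -xw ffunE.
rewrite (_ : _ `&` _ = set0) ?measure0 ?mul0e// predeqE => w.
by split=> // -[Xu xw]; move: ux; rewrite -xw ffunE Xu eqxx.
Qed.

Lemma measurable_history_pred n (C : pred {ffun 'I_n.+1 -> state N r}) :
  measurable [set w | C (history n w)].
Proof.
have -> : [set w | C (history n w)] =
    \bigcup_(x in [set x | C x]) [set w | history n w = x].
  rewrite predeqE => w; split=> [Cw|[x Cx xw]]; first by exists (history n w).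
  by rewrite /= xw.
by apply: fin_bigcup_measurable => [|x _];
  [exact: finite_finset | exact: measurable_history].
Qed.

Lemma transitionE s t : transition P s t = P (state_index s) (state_index t).
Proof. by rewrite /transition mxE. Qed.

Lemma levels_leE k :
  levels_le k = [set s : state N r | low_level k (state_index s)].
Proof. by rewrite predeqE => s; rewrite /= /low_level tagnat.Rank1K. Qed.

Section Taboo.
Variable B : pred 'I_(\sum_(i < N.+1) r).

Let A : set (state N r) := [set s | B (state_index s)].

Definition avoiding_history n : pred {ffun 'I_n.+1 -> state N r} :=
  fun x => [forall i : 'I_n.+1, (0 < i)%N ==> ~~ B (state_index (x i))].

Lemma avoidsE n : avoids X A n = [set w | avoiding_history (history n w)].
Proof.
rewrite predeqE => w; split=> [Aw|/forallP Aw m /andP[m0 mn] Am].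
  apply/forallP => i; apply/implyP => i0; rewrite ffunE; apply/negP.
  by apply: Aw; rewrite i0 -ltnS ltn_ord.
have BX : B (state_index (X m w)) by [].
by have := Aw (inord m); rewrite ffunE inordK ?ltnS// m0 /= BX.
Qed.

Lemma measurable_avoids n : measurable (avoids X A n).
Proof. by rewrite avoidsE; exact: measurable_history_pred. Qed.

Lemma avoidsS n t : [set w | X n.+1 w = t] `&` avoids X A n.+1 =
  if B (state_index t) then set0 else [set w | X n.+1 w = t] `&` avoids X A n.
Proof.
case: ifPn => Bt; rewrite predeqE => w; split=> //.
- by move=> [Xt /(_ n.+1)]; rewrite ltnSn => /(_ isT)[]; rewrite Xt.
- move=> [Xt Aw]; split=> // m /andP[m0 mn]; apply: Aw.
  by rewrite m0 leqW.
- move=> [Xt Aw]; split=> // m /andP[m0].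
  rewrite leq_eqVlt => /predU1P[->|mn]; first by rewrite Xt; exact/negP.
  by apply: Aw; rewrite m0.
Qed.

(** Induction on [n] by the Markov property: the intermediate states in [A] are
    excluded, which is what the zero columns of [T_A] do. *)
Lemma taboo_law s t n :
  Pr s ([set w | X n.+1 w = t] `&` avoids X A n) =
  ((taboo_mx P B ^+ n *m P) (state_index s) (state_index t))%:E.
Proof.
elim: n t => [|n IHn] t; rewrite avoidsE.
  rewrite expr0 mul1mx markov_history -avoidsE.
  have av0 : avoids X A 0 = setT.
    by rewrite predeqE => w; split=> // _ [].
  case: hX => _ start _.
  rewrite av0 (bigD1 s)//= setIT start mul1e big1 ?adde0 ?transitionE// => u us.
  by rewrite setIT start_null ?mul0e// => w /= ->; exact/eqP.
rewrite markov_history -avoidsE.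
rewrite exprSr [in RHS]mxE (reindex _ (onW_bij _ (@state_index_bij N r)))/=.
rewrite -sumEFin; apply: eq_bigr => u _.
rewrite avoidsS EFinM transitionE; congr (_ * _)%E.
have -> x y : (taboo_mx P B ^+ n * taboo_mx P B) x y =
    (taboo_mx P B ^+ n *m P) x y *+ ~~ B y.
  rewrite !mxE -sumrMnl; apply: eq_bigr => z _.
  by rewrite [X in _ * X]mxE mulrnAr.
by case: (B _); rewrite /= ?measure0// IHn.
Qed.

Lemma measurable_taboo t n :
  measurable ([set w | X n.+1 w = t] `&` avoids X A n).
Proof. by apply: measurableI => //; exact: measurable_avoids. Qed.

Lemma first_entry_bigcup t : B (state_index t) ->
  first_entry_at X A t = \bigcup_n ([set w | X n.+1 w = t] `&` avoids X A n).
Proof.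
move=> Bt; rewrite predeqE => w.
split=> [[[|n] [// _ Aw _ Xt]]|[n _ [Xt Aw]]]; first by exists n.
by exists n.+1; split=> //=; rewrite Xt.
Qed.

Hypothesis stochP : stochastic_mx P.
Hypothesis unitB : 1%:M - taboo_mx P B \in unitmx.

Let taboo_series s t :
  (\sum_(0 <= n <oo) Pr s ([set w | X n.+1 w = t] `&` avoids X A n))%E =
  (hitting_mx P B (state_index s) (state_index t))%:E.
Proof.
under eq_eseriesr do rewrite taboo_law.
exact/eseries_EFin_cvg/taboo_mx_series_cvg.
Qed.

(** Since [t] lies in [A], a path that is at [t] cannot avoid [A] afterwards, so
    the events summed by [taboo_series] are disjoint. *)
Lemma first_entry_law s t : B (state_index t) ->
  Pr s (first_entry_at X A t) =
  (hitting_mx P B (state_index s) (state_index t))%:E.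
Proof.
move=> Bt; rewrite -taboo_series first_entry_bigcup//.
apply: measure_semi_bigcup; [exact: measurable_taboo| |].
  apply: ltn_trivIset => n m mn; rewrite -subset0 => w [[Xt _] [_ Aw]].
  by apply: (Aw m.+1); rewrite ?mn//= Xt.
by apply: bigcup_measurable => n _; exact: measurable_taboo.
Qed.

(** The visit at time 0 has probability 0 because [s != t].  At a later time
    [n + 1], avoiding [A] up to [n] or up to [n + 1] is the same, as [t] lies
    outside [A]. *)
Lemma expected_visits_law s t : ~~ B (state_index t) -> s != t ->
  expected_visits X Pr A s t =
  (hitting_mx P B (state_index s) (state_index t))%:E.
Proof.
move=> Bt st; rewrite -taboo_series /expected_visits.
have mV n : measurable (visit_before_hitting X A t n).
  by apply: measurableI => //; exact: measurable_avoids.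
rewrite integral_nneseries//; last first.
  by move=> n; apply/measurable_EFinP; exact: measurable_indic.
have indE n : (\int[Pr s]_w (\1_(visit_before_hitting X A t n) w)%:E)%E =
    Pr s (visit_before_hitting X A t n).
  by rewrite integral_indic// setIT.
under [LHS]eq_eseriesr do rewrite indE.
have st_step n : visit_before_hitting X A t n.+1 =
    [set w | X n.+1 w = t] `&` avoids X A n.
  by rewrite /visit_before_hitting avoidsS (negPf Bt).
have start0 : Pr s (visit_before_hitting X A t 0) = 0%E.
  by apply: start_null => // w [/= -> _]; apply/eqP; rewrite eq_sym.
rewrite nneseries_recl// start0 add0e -(nneseries_addn 1)//.
by apply: eq_eseriesr => n _; rewrite addn1 -st_step.
Qed.

End Taboo.

Lemma measure_start s E : measurable E ->
  Pr s E = Pr s (E `&` [set w | X 0 w = s]).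
Proof.
move=> mE; have off0 : Pr s (E `\` [set w | X 0 w = s]) = 0%E.
  by apply: start_null => [|w []//]; exact: measurableD.
have -> : Pr s E = (Pr s (E `\` [set w | X 0 w = s]) +
    Pr s (E `&` [set w | X 0 w = s]))%E by exact: measureDI.
by rewrite off0 add0e.
Qed.

Lemma measurable_censored k n t : measurable (censored_at X k n t).
Proof.
pose C m (x : {ffun 'I_m.+1 -> state N r}) :=
  [&& (\sum_(l < m) ((x (widen_ord (leqnSn m) l)).1 <= k)%N)%N == n,
      ((x ord_max).1 <= k)%N & x ord_max == t].
have -> : censored_at X k n t = \bigcup_m [set w | C m (history m w)].
  rewrite predeqE => w; split=> [[m [cnt Xk Xt]]|[m _ /and3P[]]].
    exists m => //=; rewrite /C ffunE Xt eqxx andbT -Xt Xk andbT -cnt.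
    by apply/eqP/eq_bigr => l _; rewrite ffunE.
  rewrite ffunE => /eqP cnt Xk /eqP Xt; exists m; split=> //.
  by rewrite -cnt; apply: eq_bigr => l _; rewrite ffunE.
by apply: bigcup_measurable => m _; exact: (measurable_history_pred (C m)).
Qed.

(** The start at a level at most [k] is itself visit number 0 of the censored
    chain, so its state number 1 is the state at the first return. *)
Lemma censored_law (k : nat) (s t : state N r) : (s.1 <= k)%N -> (t.1 <= k)%N ->
  Pr s (censored_at X k 1 t) = Pr s (first_entry_at X (levels_le k) t).
Proof.
move=> sk tk.
have mF : measurable (first_entry_at X (levels_le k) t).
  have Bt : low_level k (state_index t) by rewrite /low_level tagnat.Rank1K.
  rewrite levels_leE first_entry_bigcup//.
  by apply: bigcup_measurable => n _; exact: measurable_taboo.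
rewrite [RHS]measure_start// [LHS]measure_start; last first.
  exact: measurable_censored.
congr (Pr s _); rewrite predeqE => w; split=> -[hit /= X0]; split=> //.
  case: hit => -[|m] []; first by rewrite big_ord0.
  rewrite big_ord_recl X0 sk add1n => -[/eqP].
  rewrite sum_nat_eq0 => /forallP cnt Xk Xt; exists m.+1; split=> //.
  move=> [//|l] lm; have := cnt (Ordinal lm).
  by rewrite /= eqb0 => /negP.
case: hit => -[|m] [// _ Aw Xk Xt]; exists m.+1; split=> //.
rewrite big_ord_recl X0 sk big1// => l _; apply/eqP; rewrite eqb0.
by apply/negP; apply: Aw; rewrite lift0 ltn_ord.
Qed.

End Chain.

(** * The factors as blocks *)

Section Measures.
Variables (R : realType) (N r : nat) (hr : (0 < r)%N) (P : block_matrix R N r).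
Hypotheses (hP : stochastic_mx P) (hirr : irreducible_mx P).
Variables (d : measure_display) (T : measurableType d).
Variables (X : nat -> T -> state N r) (Pr : state N r -> probability T R).
Hypothesis hX : markov_chain X Pr P.

Let taboo_unit k := taboo_low_unit hr hP hirr k.

Lemma censored_blkE k i j a b : censored_blk P k i j a b =
  hitting_mx P (low_level k) (state_index (i, a)) (state_index (j, b)).
Proof. by rewrite mxE. Qed.

Lemma expected_visits_censored (i j : 'I_N.+1) a b : (i < j)%N ->
  expected_visits X Pr (levels_le j.-1) (i, a) (j, b) =
  (censored_blk P j.-1 i j a b)%:E.
Proof.
move=> ij; rewrite censored_blkE levels_leE (expected_visits_law hX)//.
  rewrite /low_level tagnat.Rank1K -ltnNge prednK//.
  exact: leq_ltn_trans ij.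
by apply: contraTneq ij => -[-> _]; rewrite ltnn.
Qed.

Lemma R_measure_censored (i j : 'I_N.+1) : (i < j)%N ->
  R_measure X Pr i j = censored_blk P j.-1 i j.
Proof.
by move=> ij; apply/matrixP => a b; rewrite mxE expected_visits_censored.
Qed.

Lemma G_measure_censored (i j : 'I_N.+1) : (j < i)%N ->
  G_measure X Pr i j = censored_blk P i.-1 i j.
Proof.
move=> ji; apply/matrixP => a b; rewrite mxE censored_blkE levels_leE.
rewrite (first_entry_law hX)//.
by rewrite /low_level tagnat.Rank1K -ltnS prednK//; exact: leq_ltn_trans ji.
Qed.

Lemma Phi_censored k : Phi X Pr k = censored_blk P k k k.
Proof.
apply/matrixP => a b; rewrite mxE censored_blkE (censored_law hX)//.
rewrite levels_leE (first_entry_law hX)//.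
by rewrite /low_level tagnat.Rank1K.
Qed.

End Measures.

Theorem lemma4p1 (R : realType) (N r : nat) (hr : (0 < r)%N)
    (P : block_matrix R N r)
    (hP : stochastic_mx P) (hirr : irreducible_mx P)
    (d : measure_display) (T : measurableType d)
    (X : nat -> T -> state N r) (Pr : state N r -> probability T R)
    (hX : markov_chain X Pr P) :
  (* the forward elimination is well defined *)
  (forall k : 'I_N.+1, (0 < k)%N -> 1%:M - gth P k k k \in unitmx) /\
  (* the expectations defining the R-measure are finite *)
  (forall (i j : 'I_N.+1) (a b : 'I_r), (i < j)%N ->
     expected_visits X Pr (levels_le j.-1) (i, a) (j, b) \is a fin_num) /\
  (* the forward elimination yields the three factors *)
  (forall i j : 'I_N.+1, (i < j)%N ->
     R_measure X Pr i j = gth P j i j *m invmx (1%:M - gth P j j j)) /\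
  (forall k : 'I_N.+1, Phi X Pr k = gth P k k k) /\
  (forall i j : 'I_N.+1, (j < i)%N ->
     G_measure X Pr i j = invmx (1%:M - gth P i i i) *m gth P i i j) /\
  1%:M - P =
    (1%:M - upper_mx (R_measure X Pr)) *m
    (1%:M - diagonal_mx (Phi X Pr)) *m
    (1%:M - lower_mx (G_measure X Pr)).
Proof.
have gthE k i j := gth_censored hr hP hirr k i j.
have RE (i j : 'I_N.+1) : (i < j)%N -> R_measure X Pr i j =
    censored_blk P j i j *m invmx (1%:M - censored_blk P j j j).
  move=> ij; rewrite (R_measure_censored hr hP hirr hX)//.
  rewrite censored_block_visits//.
  exact: leq_ltn_trans ij.
have PhiE k : Phi X Pr k = censored_blk P k k k by exact: Phi_censored.
have GE (i j : 'I_N.+1) : (j < i)%N -> G_measure X Pr i j =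
    invmx (1%:M - censored_blk P i i i) *m censored_blk P i i j.
  move=> ji; rewrite (G_measure_censored hr hP hirr hX)//.
  rewrite censored_block_return//.
  exact: leq_ltn_trans ji.
split; first by move=> k k0; rewrite gthE; exact: censored_block_unit.
split.
  by move=> i j a b ij; rewrite (expected_visits_censored hr hP hirr hX).
split; first by move=> i j ij; rewrite !gthE; exact: RE.
split; first by move=> k; rewrite gthE.
split; first by move=> i j ji; rewrite !gthE; exact: GE.
exact: RG_factorization.
Qed.
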